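(* Let $K$ be an infinite field, $S=K[x_1,\ldots,x_n]$, let $I$ be a monomial ideal of $S$ and let $k$ be any positive integer. Then the $k$-th symbolic power of $I$ is $$I^{(k)}=\bigcap_{B\in \mathcal{N}({}_I\triangle)}J(I^k,P_B).$$ Furthermore, $J(I,P_B)^k=J(I,P_B)^{(k)}$ holds for each $B\in\mathcal{N}({}_I\triangle)$, and thus $$I^{(k)}=\bigcap_{B\in \mathcal{N}({}_I\triangle)}J(I,P_B)^k=\bigcap_{P\in \mathrm{Min}(I)}\big[\ker(S\to (S/I)_P)\big]^k.$$
   Context: Write $[n]=\{1,\ldots,n\}$. For a monomial $u=x_1^{a_1}\cdots x_n^{a_n}$ and $A\subseteq[n]$, put $u(A)=\prod_{i\in A}x_i^{a_i}$. For a monomial ideal $I$ with minimal set of monomial generators $G_{min}(I)$, put $I(A)=\{u(A)\mid u\in G_{min}(I)\}$. The eliminating simplicial complex of $I$ is ${}_I\triangle=\{A\subseteq[n]\mid \langle I(A)\rangle=S\}$ (a family of subsets of $[n]$ closed under taking subsets, not required to contain all singletons). $\mathcal{N}({}_I\triangle)$ is the set of minimal nonfaces of ${}_I\triangle$, i.e. the inclusion-minimal subsets of $[n]$ not in ${}_I\triangle$. For $B\subseteq[n]$, $P_B=\langle x_i\mid i\in B\rangle$. For an ideal $L$ and a prime ideal $P$ of $S$, $J(L,P)=\{f\in S\mid \exists\, g\in S\setminus P \text{ with } fg\in L\}=\ker(S\to(S/L)_P)$. $\mathrm{Min}(L)$ is the set of prime ideals minimal over $L$, and the $k$-th symbolic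 power of an ideal $L$ is $L^{(k)}=\bigcap_{P\in\mathrm{Min}(L)}\ker\big(S\to(S/L^k)_P\big)$. *)

(* Defs.v *)
From HB Require Import structures.
From mathcomp Require Import all_boot all_order all_algebra.
From mathcomp Require Import mpoly.
From mathcomp Require Import boolp classical_sets cardinality.

Set Implicit Arguments.
Unset Strict Implicit.
Unset Printing Implicit Defensive.

Import GRing.Theory.

Local Open Scope ring_scope.
Local Open Scope classical_set_scope.

Section Ideals.
Variable R : comNzRingType.
Implicit Types (L P : set R) (k : nat).

(* [idealr_closed] of ring_quotient only covers proper ideals, whereas the
   unit ideal must be allowed here. *)
Definition ideal L : Prop :=
  [/\ L 0, (forall f g, L f -> L g -> L (f + g))
    & forall a f, L f -> L (a * f)].

Definition ideal_gen (X : set R) : set R := smallest ideal X.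

Definition ideal_pow L k : set R :=
  ideal_gen [set f | exists2 g : 'I_k -> R,
                       forall i, L (g i) & f = \prod_(i < k) g i].

Definition prime_ideal P : Prop :=
  idealr_closed (mem P) /\ prime_idealr_closed (mem P).

Definition minimal_primes L : set (set R) :=
  [set P | [/\ prime_ideal P, L `<=` P
    & forall Q, prime_ideal Q -> L `<=` Q -> Q `<=` P -> Q = P]].

(* Equality in (R/L)_P of the fractions x.1/x.2 and y.1/y.2, where elements of
   R/L are given by representatives in R and x.2, y.2 lie outside P. *)
Definition loc_eq L P (x y : R * R) : Prop :=
  exists2 t, ~ P t & L (t * (y.2 * x.1 - x.2 * y.1)).

(* ker (R -> (R/L)_P), where f is mapped to f/1 *)
Definition loc_ker L P : set R := [set f | loc_eq L P (f, 1) (0, 1)].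

Definition idealJ L P : set R := [set f | exists2 g, ~ P g & L (f * g)].

Definition symbolic_power L k : set R :=
  \bigcap_(P in minimal_primes L) loc_ker (ideal_pow L k) P.

End Ideals.

Section MonomialIdeals.
Variables (K : fieldType) (n : nat).
Implicit Types (I : set {mpoly K[n]}) (G : set 'X_{1..n}) (A B : {set 'I_n}).

Definition monomial_gen G : set {mpoly K[n]} :=
  ideal_gen [set 'X_[m] | m in G].

Definition monomial_ideal I : Prop := exists G, I = monomial_gen G.

(* The inclusion-minimal set of monomials generating I; it exists and is
   unique when I is a monomial ideal, and [get] is only meant for that case. *)
Definition min_gens I : set 'X_{1..n} :=
  [get G | I = monomial_gen G /\
           forall H, H `<=` G -> I = monomial_gen H -> H = G].

Definition mon_restr (m : 'X_{1..n}) A : {mpoly K[n]} :=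
  \prod_(i in A) 'X_i ^+ m i.

Definition gens_restr I A : set {mpoly K[n]} :=
  [set mon_restr m A | m in min_gens I].

Definition elim_complex I : set {set 'I_n} :=
  [set A | ideal_gen (gens_restr I A) = setT].

Definition minimal_nonfaces (D : set {set 'I_n}) : set {set 'I_n} :=
  [set B | ~ D B /\ forall A, A \subset B -> ~ D A -> A = B].

Definition var_prime B : set {mpoly K[n]} :=
  ideal_gen [set f | exists2 i, i \in B & f = 'X_i].

End MonomialIdeals.

Arguments var_prime K {n} B.

(* Main.v *)
(* A set A is a nonface of the eliminating complex iff every generator of I
   involves a variable of A, that is, iff I is contained in P_A; a prime Q
   containing I contains P_A for A the set of variables in Q, so the minimal
   primes of I are the P_B with B a minimal nonface. The key fact is that an
   ideal M generated by monomials in the variables of B is saturated with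
   respect to P_B: f g in M and g outside P_B imply f in M. It shows that P_B is
   prime, that J(I, P_B) is generated by the restrictions to B of the generators
   of I, and, applied to M = J(I, P_B)^k, that J(I^k, P_B) = J(I, P_B)^k. *)
Require Import Defs.
From mathcomp Require Import all_boot all_order all_algebra.
From mathcomp Require Import mpoly.
From mathcomp Require Import boolp classical_sets cardinality.

Set Implicit Arguments.
Unset Strict Implicit.
Unset Printing Implicit Defensive.

Import GRing.Theory.

Local Open Scope ring_scope.
Local Open Scope classical_set_scope.

(** * Ideals, prime ideals and localization kernels in a commutative ring *)

Section IdealTheory.
Variable R : comNzRingType.
Implicit Types (L M P X : set R) (k : nat).

Lemma ideal_gen_ideal X : ideal (ideal_gen X).
Proof.
split=> [A [[A0 _ _] _] //|f g Xf Xg A AP|a f Xf A AP].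
  by case: (AP) => -[_ AD _] _; apply: AD; [exact: Xf|exact: Xg].
by case: (AP) => -[_ _ AM] _; apply: AM; exact: Xf.
Qed.

Lemma sub_ideal_gen X : X `<=` ideal_gen X.
Proof. exact: sub_gen_smallest. Qed.

Lemma ideal_gen_sub X L : ideal L -> X `<=` L -> ideal_gen X `<=` L.
Proof. exact: smallest_sub. Qed.

Lemma ideal_sum L (T : eqType) (r : seq T) (F : T -> R) :
  ideal L -> (forall x, x \in r -> L (F x)) -> L (\sum_(x <- r) F x).
Proof.
move=> [L0 LD _] LF; rewrite big_seq.
by elim/big_ind: _ => [//|f g|x /LF //]; exact: LD.
Qed.

Lemma ideal_eq_setT L : ideal L -> L = setT <-> L 1.
Proof.
move=> [_ _ LM]; split=> [->//|L1].
by apply/seteqP; split=> // f _; rewrite -[f]mulr1; exact: LM.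
Qed.

Lemma ideal_pow_ideal L k : ideal (ideal_pow L k).
Proof. exact: ideal_gen_ideal. Qed.

Lemma ideal_pow_prod L k (f : 'I_k -> R) :
  (forall i, L (f i)) -> ideal_pow L k (\prod_(i < k) f i).
Proof. by move=> Lf; apply: sub_ideal_gen; exists f. Qed.

Lemma ideal_pow_sub L M k : L `<=` M -> ideal_pow L k `<=` ideal_pow M k.
Proof.
move=> LM; apply: ideal_gen_sub; first exact: ideal_pow_ideal.
by move=> _ [f Lf ->]; apply: ideal_pow_prod => i; exact/LM/Lf.
Qed.

(** Unpacks the boolean closure predicates: closure under [a * f + g] gives sums for [a = 1] and
    multiples for [g = 0]. *)
Lemma prime_idealP P :
  prime_ideal P <-> [/\ ideal P, ~ P 1 & forall f g, P (f * g) -> P f \/ P g].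
Proof.
have memP f : (f \in (mem P : {pred R})) = (f \in P) by [].
split=> [[[]]|[[P0 PD PM] P1 PMP]].
  rewrite !memP => /set_mem P0 /negP P1 Plin Pprime; split.
  - split=> // [f g Pf Pg|a f Pf].
      by have /set_mem := Plin 1 f g (mem_set Pf) (mem_set Pg); rewrite mul1r.
    by have /set_mem := Plin a f 0 (mem_set Pf) (mem_set P0); rewrite addr0.
  - by move=> /mem_set /P1.
  - by move=> f g /mem_set /Pprime /orP[] /set_mem; [left|right].
split; first split.
- exact: mem_set.
- by apply/negP => /set_mem.
- by move=> a f g /set_mem Pf /set_mem Pg; apply: mem_set; apply: PD => //; exact: PM.
- by move=> f g /set_mem /PMP[] /mem_set Pf; apply/orP; [left|right].
Qed.

Lemma prime_ideal_prod P k (f : 'I_k -> R) :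
  prime_ideal P -> (forall i, ~ P (f i)) -> ~ P (\prod_(i < k) f i).
Proof.
move=> /prime_idealP[_ P1 PM] nPf.
by elim/big_ind: _ => [//|g h nPg nPh /PM[]//|i _]; exact: nPf.
Qed.

Lemma loc_kerE L P : loc_ker L P = idealJ L P.
Proof.
apply/seteqP; split=> f [t Pt Lt]; exists t => //=.
  by move: Lt; rewrite /= mulr0 subr0 mul1r mulrC.
by rewrite mulr0 subr0 mul1r mulrC.
Qed.

Lemma sub_idealJ L P : ~ P 1 -> L `<=` idealJ L P.
Proof. by move=> P1 f Lf; exists 1; rewrite ?mulr1. Qed.

Lemma idealJ_ideal L P : ideal L -> prime_ideal P -> ideal (idealJ L P).
Proof.
move=> [L0 LD LM] /prime_idealP[_ P1 PM]; split.
- by exists 1; rewrite ?mul0r.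
- move=> f g [s Ps Lfs] [t Pt Lgt]; exists (s * t); first by move=> /PM[].
  rewrite mulrDl; apply: LD; last by rewrite mulrCA; exact: LM.
  by rewrite mulrA mulrC; exact: LM.
- by move=> a f [s Ps Lfs]; exists s => //; rewrite -mulrA; exact: LM.
Qed.

Lemma idealJ_sub_prime L P : prime_ideal P -> L `<=` P -> idealJ L P `<=` P.
Proof. by move=> /prime_idealP[_ _ PM] LP f [g nPg /LP /PM[]]. Qed.

(** Each factor of a generator has a multiplier outside [P]; their product is again outside the
    prime [P] and moves the whole product into the power of [L]. *)
Lemma idealJ_pow_sub L P k : prime_ideal P ->
  ideal_pow (idealJ L P) k `<=` idealJ (ideal_pow L k) P.
Proof.
move=> pP; apply: ideal_gen_sub.
  by apply: idealJ_ideal => //; exact: ideal_pow_ideal.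
move=> _ [f Jf ->].
have {Jf} /choice[g fg] i : exists g, ~ P g /\ L (f i * g).
  by have [g] := Jf i; exists g.
exists (\prod_(i < k) g i); first by apply: prime_ideal_prod => // i; case: (fg i).
by rewrite -big_split /=; apply: ideal_pow_prod => i; case: (fg i).
Qed.

Lemma sub_symbolic_power L k : ideal_pow L k `<=` symbolic_power L k.
Proof.
move=> f Lf P [/prime_idealP[_ P1 _] _ _].
by rewrite loc_kerE; exact: sub_idealJ.
Qed.

End IdealTheory.

(** * Membership in monomial ideals and minimal generators *)

Section MonomialIdealTheory.
Variables (K : fieldType) (n : nat).
Implicit Types (I : set {mpoly K[n]}) (G H : set 'X_{1..n}) (A B : {set 'I_n}).
Implicit Types (f g : {mpoly K[n]}) (m u v : 'X_{1..n}).

Definition up_set G : set 'X_{1..n} := [set m | exists2 u, G u & (u <= m)%MM].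

Lemma monomial_gen_ideal G : ideal (monomial_gen (K:=K) G).
Proof. exact: ideal_gen_ideal. Qed.

(** The polynomials supported in [up_set G] form an ideal containing the generators; conversely,
    each term of such a polynomial is a multiple of a generator. *)
Lemma monomial_genP G f :
  monomial_gen G f <-> {subset msupp f <= up_set G}.
Proof.
split=> [|fG].
  move: f; apply: (ideal_gen_sub (L := [set f | {subset msupp f <= up_set G}])).
    split=> [m|f g fG gG m|a f fG m /=]; first by rewrite msupp0.
      by move=> /msuppD_le; rewrite mem_cat => /orP[/fG|/gG].
    move=> /msuppM_le /allpairsP[[u v] /= [_ /fG /set_mem[w Gw wv] ->]].
    apply: mem_set; exists w => //; apply: lepm_trans wv _; exact: lem_addl.
  move=> _ [u Gu <-] m /mem_msuppXP <-.
  by apply: mem_set; exists u => //; exact: lepm_refl.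
rewrite [f]mpolyE; apply: ideal_sum; first exact: monomial_gen_ideal.
move=> m /fG /set_mem[u Gu um].
have [_ _ LM] := monomial_gen_ideal G.
rewrite -(submK um) mpolyXD -mul_mpolyC mulrA; apply: LM.
by apply: sub_ideal_gen; exists u.
Qed.

Lemma monomial_genX G m : monomial_gen G ('X_[m] : {mpoly K[n]}) <-> up_set G m.
Proof.
split=> [/monomial_genP GX|Gm]; first by apply/set_mem/GX/mem_msuppXP.
by apply/monomial_genP => _ /mem_msuppXP <-; exact: mem_set.
Qed.

Lemma monomial_gen_sub G I : ideal I ->
  (forall m, G m -> I 'X_[m]) -> monomial_gen G `<=` I.
Proof. by move=> Iid GI; apply: ideal_gen_sub => // _ [m Gm <-]; exact: GI. Qed.

Lemma monomial_gen_up_setS G G' : G `<=` up_set G' ->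
  monomial_gen (K:=K) G `<=` monomial_gen G'.
Proof.
move=> GG'; apply: monomial_gen_sub => [|m /GG' ?]; last exact/monomial_genX.
exact: monomial_gen_ideal.
Qed.

(** Since [min_gens] is defined by [get], an inclusion-minimal generating set must be exhibited: the
    divisibility-minimal elements of any generating set. *)
Lemma min_gensP I : monomial_ideal I -> I = monomial_gen (min_gens I).
Proof.
move=> [G ->].
suff [H HP] : exists H, monomial_gen G = monomial_gen (K:=K) H /\
    forall H', H' `<=` H -> monomial_gen G = monomial_gen (K:=K) H' -> H' = H.
  by rewrite /min_gens; case: xgetP => [G' _ []//|/(_ H)[]].
have minG m : G m -> exists2 u, G u /\ (forall v, G v -> (v <= u)%MM -> v = u)
                              & (u <= m)%MM.
  (* Induction on a bound for the degree: a proper divisor of [m] has smaller degree. *)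
  elim: (mdeg m) {-2}m (leqnn (mdeg m)) => [|d IH] {}m md Gm.
    exists m; rewrite ?lepm_refl//; split=> // v _ vm.
    move: md; rewrite leqn0 mdeg_eq0 => /eqP m0; move: vm; rewrite m0.
    by move=> /mnm_lepP v0; apply/mnmP => i; move: (v0 i); rewrite mnm0E leqn0 => /eqP.
  have [[v [Gv vm nvm]]|mmin] := pselect (exists v, [/\ G v, (v <= m)%MM & v <> m]).
    have vd : (mdeg v <= d)%N.
      have mE := submK vm.
      have : (mdeg (m - v) != 0)%N.
        by rewrite mdeg_eq0; apply: contra_notN nvm => /eqP mv0; rewrite -mE mv0 add0m.
      move: md; rewrite -{1}mE mdegD -lt0n => md d0.
      by rewrite -ltnS; apply: leq_trans md; rewrite -add1n leq_add2r.
    have [u uP uv] := IH v vd Gv; exists u => //; exact: lepm_trans uv vm.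
  exists m; rewrite ?lepm_refl//; split=> // v Gv vm.
  by apply: contrapT => nvm; apply: mmin; exists v.
exists [set u | G u /\ forall v, G v -> (v <= u)%MM -> v = u]; split.
  apply/seteqP; split; apply: monomial_gen_up_setS.
    by move=> m /minG[u uP um]; exists u.
  by move=> m [Gm _]; exists m => //; exact: lepm_refl.
move=> H' H'G eqH'; apply/seteqP; split=> // m [Gm mmin].
(* Some element of [H'] divides [m]; it lies in [G], so minimality of [m] makes it equal to [m]. *)
have : monomial_gen (K:=K) H' 'X_[m].
  by rewrite -eqH'; apply/monomial_genX; exists m => //; exact: lepm_refl.
move=> /monomial_genX[u H'u um].
by rewrite -(mmin u) //; case: (H'G _ H'u).
Qed.

(** * The ideals P_B generated by variables *)

Definition supported_in B G := forall m, G m -> forall i, i \notin B -> m i = 0%N.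

Lemma var_primeE B :
  var_prime K B = monomial_gen [set U_(i)%MM | i in [set` B]].
Proof.
rewrite /var_prime /monomial_gen; congr ideal_gen.
apply/seteqP; split=> f; first by move=> [i iB ->]; exists U_(i)%MM => //; exists i.
by move=> [_ [i iB <-] <-]; exists i.
Qed.

Lemma var_primeP B f :
  var_prime K B f <-> {in msupp f, forall m, exists2 i, i \in B & m i != 0%N}.
Proof.
rewrite var_primeE; split=> [/monomial_genP fB m /fB /set_mem|fB].
  by move=> [_ [i iB <-]]; rewrite lep1mP; exists i.
apply/monomial_genP => m /fB[i iB mi]; apply: mem_set.
by exists U_(i)%MM; rewrite ?lep1mP//; exists i.
Qed.

Lemma var_primeX B m : var_prime K B 'X_[m] <-> exists2 i, i \in B & m i != 0%N.
Proof.
split=> [/var_primeP|iB]; first by apply; exact/mem_msuppXP.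
by apply/var_primeP => _ /mem_msuppXP <-.
Qed.

Lemma var_prime1 B : ~ var_prime K B 1.
Proof. by rewrite -mpolyX0 => /var_primeX[i _]; rewrite mnm0E. Qed.

(** * Partial degrees in the variables of [B], and saturation with respect to P_B *)

Definition wt B m := (\sum_(i in B) m i)%N.

Lemma wtD B u v : wt B (u + v)%MM = (wt B u + wt B v)%N.
Proof. by rewrite /wt -big_split; apply: eq_bigr => i _; exact: mnmDE. Qed.

Lemma wt_eq0 B m : (wt B m == 0)%N = [forall i in B, m i == 0%N].
Proof. by rewrite sum_nat_eq0. Qed.

Definition cut (p : pred 'X_{1..n}) f := \sum_(m <- msupp f | p m) f@_m *: 'X_[m].

Lemma mcoeff_cut p f m : (cut p f)@_m = if p m then f@_m else 0.
Proof.
rewrite /cut raddf_sum /=.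
have [mf|mf] := boolP (m \in msupp f); last first.
  rewrite (memN_msupp_eq0 mf) if_same big_seq_cond big1// => u /andP[uf _].
  by rewrite mcoeffZ mcoeffX; case: eqP uf mf => [->->//|]; rewrite mulr0.
rewrite big_mkcond (bigD1_seq m) //= big1 ?addr0 => [|u um].
  by case: (p m) => //; rewrite mcoeffZ mcoeffX eqxx mulr1.
by case: (p u) => //; rewrite mcoeffZ mcoeffX (negPf um) mulr0.
Qed.

Lemma msupp_cut p f m : (m \in msupp (cut p f)) = p m && (m \in msupp f).
Proof. by rewrite !mcoeff_msupp mcoeff_cut; case: (p m); rewrite // eqxx. Qed.

Lemma msupp_subcut p f m : (m \in msupp (f - cut p f)) = ~~ p m && (m \in msupp f).
Proof.
rewrite !mcoeff_msupp mcoeffB mcoeff_cut.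
by case: (p m); rewrite ?subr0// subrr eqxx.
Qed.

(* Among the terms of f outside the ideal, keep those of least weight in the
   variables of B, and in g those of weight 0 (there are some since g is not in
   P_B). The product of the leading terms of these two parts cannot cancel in
   f * g, nor lie in the ideal, whose membership ignores variables outside B. *)
Lemma monomial_gen_saturated B G f g : supported_in B G ->
  ~ var_prime K B g -> monomial_gen G (f * g) -> monomial_gen G f.
Proof.
move=> GB gB fgG; apply: contrapT => fG.
pose bad m := m \notin up_set G.
have [m0 m0f m0bad] : exists2 m, m \in msupp f & bad m.
  apply: contrapT => nbad; apply/fG/monomial_genP => m mf.
  by apply: contrapT => /negP mG; apply: nbad; exists m.
have exd : exists d, has (fun m => bad m && (wt B m == d)) (msupp f).
  by exists (wt B m0); apply/hasP; exists m0 => //; rewrite m0bad eqxx.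
case: (ex_minnP exd) => d /hasP[m1 m1f m1d] dmin.
pose p m := bad m && (wt B m == d).
pose q m := (wt B m == 0)%N.
have f0 : cut p f != 0.
  by rewrite -msupp_eq0; apply/eqP => e; have := msupp_cut p f m1; rewrite e [p m1]m1d m1f.
have g0 : cut q g != 0.
  rewrite -msupp_eq0; apply/eqP => e; apply/gB/var_primeP => m mg.
  have := msupp_cut q g m; rewrite e mg andbT /q wt_eq0 => /esym/negbT.
  by rewrite negb_forall => /existsP[i]; rewrite negb_imply => /andP[iB mi]; exists i.
pose u := mlead (cut p f); pose v := mlead (cut q g).
have /andP[/andP[ubad /eqP ud] _] : p u && (u \in msupp f).
  by rewrite -msupp_cut mlead_supp.
have /andP[/eqP v0 _] : q v && (v \in msupp g) by rewrite -msupp_cut mlead_supp.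
(* A generator dividing the product monomial already divides that of [u]: it vanishes off [B], and
   [v] vanishes on [B]. *)
have uvbad : (u + v)%MM \notin up_set G.
  apply: contra ubad => /set_mem[w Gw /mnm_lepP wuv]; apply: mem_set.
  exists w => //; apply/mnm_lepP => i; have [iB|/GB -> //] := boolP (i \in B).
  have /eqP vi : v i == 0%N by move/eqP: v0; rewrite wt_eq0 => /forall_inP; exact.
  by rewrite -[u i]addn0 -vi -mnmDE.
suff : (u + v)%MM \in msupp (f * g) by move=> /(proj1 (monomial_genP _ _) fgG); apply/negP.
(* The monomial [u + v] has weight [d] and is the leading one of the first product; monomials of the
   second product have weight above [d]. *)
have -> : f * g = cut p f * cut q g + cut p f * (g - cut q g) + (f - cut p f) * g.
  by rewrite -mulrDr subrKC -mulrDl subrKC.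
rewrite mcoeff_msupp !mcoeffD mleadcM.
have /memN_msupp_eq0 -> : (u + v)%MM \notin msupp (cut p f * (g - cut q g)).
  apply/negP => /msuppM_le/allpairsP[[a b] /= []].
  rewrite msupp_cut msupp_subcut => /andP[/andP[_ /eqP ad] _] /andP[qb _] uvE.
  have := congr1 (wt B) uvE; rewrite !wtD ud v0 ad => /addnI/esym/eqP.
  by apply/negP.
(* A factor [a] from [f - cut p f] either lies in [up_set G], which would put [u + v] there, or has
   weight above [d] by the choice of [d]. *)
have /memN_msupp_eq0 -> : (u + v)%MM \notin msupp ((f - cut p f) * g).
  apply/negP => /msuppM_le/allpairsP[[a b] /= []].
  rewrite msupp_subcut => /andP[pa af] bg uvE.
  have abad : bad a.
    apply: contra uvbad => /set_mem[w Gw wa]; apply: mem_set; exists w => //.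
    by rewrite uvE; apply: lepm_trans wa _; exact: lem_addr.
  have da : (d <= wt B a)%N.
    by apply: dmin; apply/hasP; exists a => //; rewrite abad eqxx.
  have := congr1 (wt B) uvE; rewrite !wtD ud v0 addn0 => dE.
  move: pa; rewrite /p abad /= => /negP; apply.
  by rewrite eqn_leq da andbT dE leq_addr.
by rewrite !addr0 mulf_neq0 // mleadc_eq0.
Qed.

(** Saturation applied to P_B itself, whose generators are variables of [B]. *)
Lemma var_prime_prime B : prime_ideal (var_prime K B).
Proof.
apply/prime_idealP; split.
- exact: ideal_gen_ideal.
- exact: var_prime1.
- move=> f g fgB; have [gB|gB] := pselect (var_prime K B g); first by right.
  left; move: fgB; rewrite {1 2}var_primeE; apply: monomial_gen_saturated gB.
  move=> _ [j jB <-] i iB; rewrite mnm1E.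
  by apply/eqP; rewrite eqb0; apply: contraNneq iB => <-.
Qed.

(** * Restricted monomials, nonfaces and minimal primes *)

Definition mrestr B m : 'X_{1..n} := [multinom if i \in B then m i else 0%N | i < n].

Lemma mon_restrE m A : mon_restr K m A = 'X_[mrestr A m].
Proof.
rewrite /mon_restr big_mkcond mpolyXE_id; apply: eq_bigr => i _.
by rewrite mnmE; case: (i \in A).
Qed.

Lemma mrestr_le B m : (mrestr B m <= m)%MM.
Proof. by apply/mnm_lepP => i; rewrite mnmE; case: ifP. Qed.

Lemma mrestr_supported B G : supported_in B [set mrestr B m | m in G].
Proof. by move=> _ [m _ <-] i /negPf iB; rewrite mnmE iB. Qed.

Lemma sub_var_primeP G B : monomial_gen (K:=K) G `<=` var_prime K B <->
  forall m, G m -> exists2 i, i \in B & m i != 0%N.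
Proof.
split=> [GB m Gm|GB].
  apply/var_primeX; apply: GB; apply/monomial_genX.
  by exists m => //; exact: lepm_refl.
apply: monomial_gen_sub => [|m /GB ?]; first exact: ideal_gen_ideal.
exact/var_primeX.
Qed.

(** The restricted generators generate the unit ideal iff one of them is 1, that is, iff some
    generator involves no variable of [A]. *)
Lemma elim_complexP I A : monomial_ideal I ->
  elim_complex I A <-> ~ (I `<=` var_prime K A).
Proof.
move=> /min_gensP IE; rewrite [X in X `<=` _]IE sub_var_primeP.
rewrite /elim_complex /= ideal_eq_setT; last exact: ideal_gen_ideal.
have -> : gens_restr I A = [set 'X_[m] | m in [set mrestr A m | m in min_gens I]].
  rewrite image_comp; apply/seteqP.
  by split=> f [m mI <-]; exists m; rewrite //= mon_restrE.
rewrite -[ideal_gen _]/(monomial_gen _) -mpolyX0 monomial_genX; split.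
  move=> [_ [m mI <-] /mnm_lepP m0] /(_ m mI)[i iA /eqP]; apply.
  by move: (m0 i); rewrite mnmE iA mnm0E leqn0 => /eqP.
move=> nA; apply: contrapT => nG; apply: nA => m mI.
apply: contrapT => mA; apply: nG; exists (mrestr A m); first by exists m.
apply/mnm_lepP => i; rewrite mnmE mnm0E; case: ifP => // iA.
by rewrite leqn0; apply/negPn/negP => mi; apply: mA; exists i.
Qed.

Lemma minimal_nonfacesP I B : monomial_ideal I ->
  minimal_nonfaces (elim_complex I) B <->
  I `<=` var_prime K B /\ forall A, A \subset B -> I `<=` var_prime K A -> A = B.
Proof.
move=> monI; split=> -[IB Bmin]; split.
- by apply: contrapT => nIB; apply/IB/elim_complexP.
- by move=> A AB IA; apply: Bmin => // /elim_complexP; exact.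
- by move=> /elim_complexP; exact.
- move=> A AB nA; apply: Bmin => //; apply: contrapT => nIA.
  by apply/nA/elim_complexP.
Qed.

Lemma exists_minimal_nonface I A : monomial_ideal I -> I `<=` var_prime K A ->
  exists2 B, minimal_nonfaces (elim_complex I) B & B \subset A.
Proof.
move=> monI IA.
have [B /minsetP[/asboolP IB Bmin] BA] :=
  @minset_exists _ (fun B => `[< I `<=` var_prime K B >]) A (asboolT IA).
exists B => //; apply/minimal_nonfacesP => //; split=> // C CB IC.
by apply: Bmin => //; exact: asboolT.
Qed.

Lemma var_primeS A B : A \subset B <-> var_prime K A `<=` var_prime K B.
Proof.
split=> [/fintype.subsetP AB f /var_primeP fA|AB].
  by apply/var_primeP => m /fA[i /AB iB mi]; exists i.
apply/fintype.subsetP => i iA.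
have /AB/var_primeX[j jB] : var_prime K A 'X_[U_(i)].
  by apply/var_primeX; exists i; rewrite ?mnm1E ?eqxx.
by rewrite mnm1E eqb0 negbK => /eqP ->.
Qed.

Lemma prime_contains_var_prime I Q : monomial_ideal I -> prime_ideal Q ->
  I `<=` Q -> exists2 B, minimal_nonfaces (elim_complex I) B & var_prime K B `<=` Q.
Proof.
move=> monI primeQ IQ; have /prime_idealP[Qid Q1 _] := primeQ.
pose A := [set i : 'I_n | `[< Q 'X_i >]]%SET.
have AQ : var_prime K A `<=` Q.
  by apply: ideal_gen_sub => // _ [i + ->]; rewrite inE => /asboolP.
have IA : I `<=` var_prime K A.
  (* A generator avoiding [A] would be a product of variables outside the prime [Q], hence outside
     [Q]. *)
  move: IQ; have [G ->] := monI => GQ; apply/sub_var_primeP => m Gm.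
  apply: contrapT => mA.
  have : Q 'X_[m] by apply/GQ/monomial_genX; exists m => //; exact: lepm_refl.
  rewrite mpolyXE_id; apply: prime_ideal_prod => // i.
  have [->|mi] := eqVneq (m i) 0%N; first by rewrite expr0.
  rewrite -[m i]card_ord -prodr_const; apply: prime_ideal_prod => // _ Qi.
  by apply: mA; exists i => //; rewrite inE; exact: asboolT.
have [B Bmin BA] := exists_minimal_nonface monI IA.
by exists B => //; apply: subset_trans AQ; exact/var_primeS.
Qed.

(** A minimal prime contains some P_B, which contains [I], so they agree. Conversely, a prime [Q]
    between [I] and P_B contains some P_C; then [C] lies in [B], and minimality of [B] gives
    equality. *)
Lemma minimal_primes_monomial I : monomial_ideal I ->
  minimal_primes I = [set var_prime K B | B in minimal_nonfaces (elim_complex I)].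
Proof.
move=> monI; apply/seteqP; split=> [P [primeP IP Pmin]|_ [B Bmin <-]].
  have [B Bmin BP] := prime_contains_var_prime monI primeP IP.
  exists B => //; apply: Pmin => //; first exact: var_prime_prime.
  by case/(minimal_nonfacesP _ monI): Bmin.
have [IB Buniq] := (minimal_nonfacesP _ monI).1 Bmin.
split=> // [|Q primeQ IQ QB]; first exact: var_prime_prime.
have [C /(minimal_nonfacesP _ monI)[IC _] CQ] := prime_contains_var_prime monI primeQ IQ.
apply/seteqP; split=> //.
by rewrite -(Buniq C) //; apply/var_primeS/(subset_trans CQ).
Qed.

(** * Localization at P_B and powers *)

(** The restricted generators divide the original ones and generate a saturated ideal, which gives
    one inclusion. For the other, the multiplier is the complementary monomial, which has no
    variable of [B]. *)
Lemma idealJ_var_prime G B :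
  idealJ (monomial_gen G) (var_prime K B) = monomial_gen [set mrestr B m | m in G].
Proof.
apply/seteqP; split.
  move=> f [g gB fgG]; apply: monomial_gen_saturated gB _.
    exact: mrestr_supported.
  apply: monomial_gen_up_setS fgG => m Gm.
  by exists (mrestr B m); [exists m|exact: mrestr_le].
apply: monomial_gen_sub.
  by apply: idealJ_ideal; [exact: monomial_gen_ideal|exact: var_prime_prime].
move=> _ [m Gm <-]; exists 'X_[m - mrestr B m].
  by move=> /var_primeX[i iB]; rewrite mnmBE mnmE iB subnn.
rewrite -mpolyXD addmC (submK (mrestr_le B m)); apply/monomial_genX.
by exists m => //; exact: lepm_refl.
Qed.

(** Exponents of the [k]-fold products of generators; for [k = 0] only the zero exponent, in
    accordance with the unit ideal. *)
Definition sums_of G k : set 'X_{1..n} :=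
  [set m | exists2 u : 'I_k -> 'X_{1..n}, forall i, G (u i) &
           m = (\sum_(i < k) u i)%MM].

Lemma sums_of_supported B G k : supported_in B G -> supported_in B (sums_of G k).
Proof.
move=> GB _ [u Gu ->] i iB; rewrite mnm_sumE big1 // => j _.
exact: GB (Gu j) i iB.
Qed.

Lemma monomial_gen_prod G k (f : 'I_k -> {mpoly K[n]}) :
  (forall i, monomial_gen G (f i)) ->
  monomial_gen (sums_of G k) (\prod_(i < k) f i).
Proof.
elim: k f => [|k IH] f fG.
  rewrite big_ord0 -mpolyX0; apply/monomial_genX; exists 0%MM; last exact: lepm_refl.
  by exists (fun=> 0%MM) => [[]//|]; rewrite big_ord0.
rewrite big_ord_recl; apply/monomial_genP.
move=> _ /msuppM_le/allpairsP[[a b] /= [af bf ->]]; apply: mem_set.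
have /set_mem[u0 Gu0 u0a] := (monomial_genP _ _).1 (fG ord0) _ af.
have /monomial_genP/(_ _ bf)/set_mem := IH (fun i => f (lift ord0 i)) (fun i => fG _).
move=> [_ [u Gu ->] ub].
exists (u0 + \sum_(i < k) u i)%MM.
  (* The family with [u0] at index 0 followed by [u]. *)
  exists (fun i => if unlift ord0 i is Some j then u j else u0) => [i|].
    by case: unliftP.
  rewrite big_ord_recl unlift_none; congr (_ + _)%MM.
  by apply: eq_bigr => i _; rewrite liftK.
apply/mnm_lepP => i; rewrite !mnmDE leq_add//.
  by move/mnm_lepP: u0a.
by move/mnm_lepP: ub.
Qed.

Lemma ideal_pow_monomial_gen G k :
  ideal_pow (monomial_gen G) k = monomial_gen (K:=K) (sums_of G k).
Proof.
apply/seteqP; split.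
  apply: ideal_gen_sub; first exact: monomial_gen_ideal.
  by move=> _ [f fG ->]; exact: monomial_gen_prod.
apply: monomial_gen_sub => [|_ [u Gu ->]]; first exact: ideal_pow_ideal.
rewrite -mprodXE; apply: ideal_pow_prod => i; apply/monomial_genX.
by exists (u i) => //; exact: lepm_refl.
Qed.

(** Restriction to [B] followed by [k]-fold sums yields generators supported in [B], so saturation
    applies. *)
Lemma idealJ_pow_saturated I B k : monomial_ideal I ->
  idealJ (ideal_pow (idealJ I (var_prime K B)) k) (var_prime K B)
    `<=` ideal_pow (idealJ I (var_prime K B)) k.
Proof.
move=> [G ->] f [g gB]; rewrite idealJ_var_prime ideal_pow_monomial_gen.
apply: monomial_gen_saturated gB.
exact/sums_of_supported/mrestr_supported.
Qed.

(** Since [I] lies in J(I, P_B), so do the [k]-th powers, and the larger power is saturated; the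
    converse multiplies denominators. *)
Lemma idealJ_pow I B k : monomial_ideal I ->
  idealJ (ideal_pow I k) (var_prime K B) = ideal_pow (idealJ I (var_prime K B)) k.
Proof.
move=> monI; apply/seteqP; split; last exact/idealJ_pow_sub/var_prime_prime.
move=> f [g gB fgI]; apply: idealJ_pow_saturated => //; exists g => //.
by move: fgI; apply: ideal_pow_sub; apply: sub_idealJ; exact: var_prime1.
Qed.

(** P_B is also a minimal prime of J(I, P_B), because a prime containing J(I, P_B) contains [I]. The
    kernel at this single prime already lies in the ordinary power. *)
Lemma symbolic_power_idealJ I B k : monomial_ideal I ->
  minimal_nonfaces (elim_complex I) B ->
  symbolic_power (idealJ I (var_prime K B)) k = ideal_pow (idealJ I (var_prime K B)) k.
Proof.
move=> monI Bmin; apply/seteqP; split; last exact: sub_symbolic_power.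
have : minimal_primes I (var_prime K B) by rewrite minimal_primes_monomial//; exists B.
move=> [primeB IB minB] f fJ; apply: idealJ_pow_saturated => //.
rewrite -loc_kerE; apply: fJ; split=> // [|Q primeQ JQ]; first exact: idealJ_sub_prime.
by apply: minB => //; apply: subset_trans JQ; apply: sub_idealJ; exact: var_prime1.
Qed.

End MonomialIdealTheory.

Theorem theorem4p7 (K : fieldType) (n : nat) (I : set {mpoly K[n]}) (k : nat)
    (Kinf : infinite_set [set: K]) (monI : monomial_ideal I) (kpos : (0 < k)%N) :
  [/\ symbolic_power I k
        = \bigcap_(B in minimal_nonfaces (elim_complex I))
            idealJ (ideal_pow I k) (var_prime K B),
      (forall B, minimal_nonfaces (elim_complex I) B ->
         ideal_pow (idealJ I (var_prime K B)) k
           = symbolic_power (idealJ I (var_prime K B)) k),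
      symbolic_power I k
        = \bigcap_(B in minimal_nonfaces (elim_complex I))
            ideal_pow (idealJ I (var_prime K B)) k
    & symbolic_power I k
        = \bigcap_(P in minimal_primes I) ideal_pow (loc_ker I P) k].
Proof.
(* The intersection over the minimal primes is reindexed by the minimal nonfaces. *)
have symI : symbolic_power I k = \bigcap_(B in minimal_nonfaces (elim_complex I))
    idealJ (ideal_pow I k) (var_prime K B).
  rewrite /symbolic_power minimal_primes_monomial // bigcap_image.
  by apply: eq_bigcapr => B _; rewrite loc_kerE.
have powI : symbolic_power I k = \bigcap_(B in minimal_nonfaces (elim_complex I))
    ideal_pow (idealJ I (var_prime K B)) k.
  by rewrite symI; apply: eq_bigcapr => B _; exact: idealJ_pow.
split=> // [B Bmin|]; first by rewrite symbolic_power_idealJ.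
rewrite powI minimal_primes_monomial // bigcap_image.
by apply: eq_bigcapr => B _; rewrite loc_kerE.
Qed.
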